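(* Let $d > 0$ be a real number and $r \geq 3$ an integer. Let $G$ be an $r$-connected graph, and let $R \subseteq V(G)$ be a set of vertices such that $G$ remains connected after removing all edges with both endpoints in $R$. If the number of connected components of $G \setminus R$ is at most $\frac{d}{r}|R|$, then there exists a set $R' \subseteq R$ with $|R'| \geq \epsilon_r(d)|R|$ such that $G \setminus R'$ is connected.
   Context: For an integer $r \geq 3$, define $\epsilon_r(d)$ for real $d>0$ by: $\epsilon_r(d) = 1 - \frac{d}{r}$ for $0 < d \leq 2$, and recursively for $d > 2$, $\epsilon_r(d) = \epsilon_r(\lceil d \rceil - 1)\left(1 - \frac{1 + d - \lceil d \rceil}{(r-1)(\lceil d \rceil - 1)}\right)$. $G \setminus X$ denotes the graph obtained from $G$ by deleting the vertex set $X$. *)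

(* Defs.v *)
From HB Require Import structures.
From mathcomp Require Import all_boot all_order all_algebra.
From mathcomp Require Import reals.

Set Implicit Arguments.
Unset Strict Implicit.
Unset Printing Implicit Defensive.

Import Order.TTheory GRing.Theory Num.Theory.

Record sgraph := SGraph {
  vertex :> finType;
  adj : rel vertex;
  adj_sym : symmetric adj;
  adj_irr : irreflexive adj
}.

Section Deletions.
Variable G : sgraph.

Section DelVerts.
Variable X : {set G}.

Definition del_verts_adj : rel {x : G | x \notin X} :=
  fun x y => adj (val x) (val y).

Lemma del_verts_sym : symmetric del_verts_adj.
Proof. by move=> x y; apply: adj_sym. Qed.

Lemma del_verts_irr : irreflexive del_verts_adj.
Proof. by move=> x; apply: adj_irr. Qed.

Definition del_verts : sgraph := SGraph del_verts_sym del_verts_irr.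
End DelVerts.

Section DelEdgesWithin.
Variable R : {set G}.

Definition del_edges_within_adj : rel G :=
  fun x y => adj x y && ~~ ((x \in R) && (y \in R)).

Lemma del_edges_within_sym : symmetric del_edges_within_adj.
Proof. by move=> x y; rewrite /del_edges_within_adj adj_sym (andbC (x \in R)). Qed.

Lemma del_edges_within_irr : irreflexive del_edges_within_adj.
Proof. by move=> x; rewrite /del_edges_within_adj adj_irr. Qed.

Definition del_edges_within : sgraph :=
  SGraph del_edges_within_sym del_edges_within_irr.
End DelEdgesWithin.

End Deletions.

Definition connected_graph (G : sgraph) : Prop :=
  (0 < #|G|) /\ forall x y : G, connect (@adj G) x y.

(* n_comp counts one root per class of connect; this is the number of
   connected components because adj is symmetric. *)
Definition num_components (G : sgraph) : nat := n_comp (@adj G) predT.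

Definition r_connected (r : nat) (G : sgraph) : Prop :=
  (r < #|G|) /\
  forall X : {set G}, #|X| < r -> connected_graph (del_verts X).

Local Open Scope ring_scope.

Section Epsilon.
Variables (K : realType) (r : nat).

(* The recursion for epsilon_r(d), with n bounding its depth; the value no
   longer depends on n once d <= n (see epsilon_le2 and epsilon_gt2). *)
Fixpoint epsilon_rec (n : nat) (d : K) : K :=
  if d <= 2 then 1 - d / r%:R else
  if n is n'.+1 then
    let c : K := (Num.ceil d)%:~R in
    epsilon_rec n' (c - 1) * (1 - (1 + d - c) / ((r%:R - 1) * (c - 1)))
  else 0.

Definition epsilon (d : K) : K := epsilon_rec `|Num.ceil d|%N d.

Lemma epsilon_le2 (d : K) : d <= 2 -> epsilon d = 1 - d / r%:R.
Proof. by rewrite /epsilon; case: `|_|%N => [|n] /= ->. Qed.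

Lemma epsilon_gt2 (d : K) (c := (Num.ceil d)%:~R : K) : 2 < d ->
  epsilon d =
    epsilon (c - 1) * (1 - (1 + d - c) / ((r%:R - 1) * (c - 1))).
Proof.
move=> d_gt2.
have : (0 < Num.ceil d)%R.
  by rewrite -(ltr_int K) (lt_le_trans _ (ceil_ge d)) // (lt_trans _ d_gt2).
rewrite /epsilon /c; case Ed: (Num.ceil d) => [[//|n]|//] _ /=.
rewrite leNgt d_gt2 /= Ed -!pmulrn -natr1 addrK.
by have -> : Num.ceil (n%:R : K) = n := intrKceil n.
Qed.

End Epsilon.

(* Main.v *)
Require Import Defs.
From mathcomp Require Import all_boot all_order all_algebra.
From mathcomp Require Import reals.
From mathcomp Require Import ring lra zify.

Set Implicit Arguments.
Unset Strict Implicit.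
Unset Printing Implicit Defensive.

Import Order.TTheory GRing.Theory Num.Theory.

(** Let [n = #|R|] and let [k] be the number of components of [G \ R]. If
    [k = 1], take [R' = R]. If [k > 1], the neighbourhood in [R] of each
    component separates it from the others, hence has at least [r] vertices, so
    by double counting some [v] in [R] touches at least [r k / n] components
    (and some [v] touches at least two, by connectivity). Dropping [v] from [R]
    merges these components, and we recurse on [(n - 1, k')].

    The bound [n * epsilon_r (r k / n)] is a maximum of linear forms in [(n, k)],
    since [epsilon_r] is convex and piecewise affine with breaks at integers
    [>= 2]. The form for the piece [[c, c + 1]] is constant in the direction
    [(1, c)], so it does not decrease when [v] touches at least [c + 1]
    components. *)

(** * Components outside [R] and the vertices touching them *)

Section Components.
Variable G : sgraph.
Implicit Types (R : {set G}) (v x y : G).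

(** The relation lives on all of [G] rather than on the subtype of vertices outside [R], so that
    components for different [R] can be compared directly. Vertices of [R] become isolated. *)
Definition adj_off R : rel G :=
  fun x y => [&& adj x y, x \notin R & y \notin R].

Definition comp_off R x : G := fingraph.root (adj_off R) x.

Definition comps_off R : {set G} := [set comp_off R x | x in ~: R].

Definition touched_comps R v : {set G} :=
  [set comp_off R y | y in ~: R & adj v y].

Lemma connect_adj_off_sym R : connect_sym (adj_off R).
Proof.
apply: sym_connect_sym => x y.
by rewrite /adj_off adj_sym [(x \notin R) && _]andbC.
Qed.

Lemma adj_off_closed R : closed (adj_off R) (~: R).
Proof. by move=> x y /and3P[_ xR yR]; rewrite !inE xR yR. Qed.

Lemma comp_offP R x y :
  reflect (comp_off R x = comp_off R y) (connect (adj_off R) x y).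
Proof.
rewrite -(root_connect (connect_adj_off_sym R)); exact: eqP.
Qed.

Lemma adj_comp_off R x y :
  adj x y -> x \notin R -> y \notin R -> comp_off R x = comp_off R y.
Proof.
by move=> xy xR yR; apply/comp_offP/connect1; rewrite /adj_off xy xR yR.
Qed.

Lemma comp_off_id R x : comp_off R (comp_off R x) = comp_off R x.
Proof. exact: root_root (connect_adj_off_sym R) x. Qed.

Lemma comps_offP R a :
  reflect (a \notin R /\ comp_off R a = a) (a \in comps_off R).
Proof.
apply: (iffP imsetP) => [[x xR ->]|[aR ae]]; last by exists a; rewrite ?inE.
split; last exact: comp_off_id.
have := closed_connect (@adj_off_closed R) (connect_root (adj_off R) x).
by rewrite xR inE.
Qed.

Lemma touched_comps_sub R v : touched_comps R v \subset comps_off R.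
Proof.
apply/subsetP => a /imsetP[y]; rewrite inE => /andP[yR _] ->.
by apply/imsetP; exists y.
Qed.

(** Once [v] is put back, the touched components all fall into the class of [v], so the remaining
    classes come from untouched components. *)
Lemma card_comps_off_del R v :
  #|comps_off (R :\ v)| + #|touched_comps R v| <= #|comps_off R|.+1.
Proof.
set R1 := R :\ v.
have sub1 : subrel (connect (adj_off R)) (connect (adj_off R1)).
  apply: connect_sub => x y /and3P[xy xR yR]; apply: connect1.
  by rewrite /adj_off xy !inE (negbTE xR) (negbTE yR) !andbF.
have compE x : comp_off R1 (comp_off R x) = comp_off R1 x.
  by apply/esym/comp_offP/sub1/connect_root.
have vR1 : v \notin R1 by rewrite !inE eqxx.
have sub : comps_off R1 \subset
    comp_off R1 v |: comp_off R1 @: (comps_off R :\: touched_comps R v).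
  apply/subsetP => _ /imsetP[x xR1 ->]; rewrite in_setU1.
  have [->|xv] := eqVneq x v; first by rewrite eqxx.
  have xR : x \in ~: R by move: xR1; rewrite !inE xv.
  have [|xT] := boolP (comp_off R x \in touched_comps R v).
    case/imsetP => y; rewrite !inE => /andP[yR vy] xy.
    rewrite -compE xy compE; apply/orP; left; apply/eqP/esym.
    by apply: adj_comp_off; rewrite // !inE (negbTE yR) andbF.
  apply/orP; right; apply/imsetP; exists (comp_off R x); last by rewrite compE.
  by rewrite in_setD xT; apply/imsetP; exists x.
have := subset_leq_card sub; rewrite cardsU1.
have := leq_imset_card (comp_off R1) (comps_off R :\: touched_comps R v).
have := cardsID (touched_comps R v) (comps_off R).
rewrite (setIidPr (touched_comps_sub R v)).
by case: (_ \notin _); lia.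
Qed.

(** * Transfer to the graph [del_verts R] *)

Lemma connect_del_verts R (x y : del_verts R) :
  connect (@adj (del_verts R)) x y = connect (adj_off R) (val x) (val y).
Proof.
apply/idP/idP.
  case/connectP => p; elim: p x => [|z p IH] x /=; first by move=> _ ->.
  case/andP => xz zp yl; apply: connect_trans (IH z zp yl); apply: connect1.
  by rewrite /adj_off (valP x) (valP z) !andbT.
case/connectP => p; move: x; elim: p => [|z p IH] x /=.
  by move=> _ /val_inj ->.
case/andP => /and3P[xz _ zR] zp yl.
apply: connect_trans (IH (Sub z zR) _ _); rewrite ?SubK //.
by apply: connect1; rewrite /= /del_verts_adj SubK.
Qed.

Lemma num_components_del_verts R :
  num_components (del_verts R) = #|comps_off R|.
Proof.
have symD : connect_sym (@adj (del_verts R)).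
  exact: sym_connect_sym (@adj_sym (del_verts R)).
have predTE : predT =1 [preim val of ~: R] :> pred (del_verts R).
  by move=> x; rewrite /= inE (valP x).
rewrite /num_components (eq_n_comp_r predTE).
(* The inclusion [val] preserves and reflects connectivity and reaches all of the closed set [~: R],
   so both sides have equally many classes. *)
rewrite -(adjunction_n_comp val (connect_adj_off_sym R) symD (@adj_off_closed R)).
  rewrite /n_comp_mem; apply: eq_card => a.
  rewrite [LHS]inE; apply/idP/comps_offP.
    by case/andP => /eqP ra; rewrite [mem _ _]inE => aR; split.
  by case=> aR ra; apply/andP; split; [apply/eqP | rewrite [mem _ _]inE].
split=> [x xR|x y _]; last exact: connect_del_verts.
have xR' : x \notin R by rewrite inE in xR.
by exists (Sub x xR'); rewrite SubK.
Qed.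

Lemma del_verts_connected R :
  #|comps_off R| = 1 -> connected_graph (del_verts R).
Proof.
move=> /eqP /cards1P[a aE].
have aR : a \notin R by have /comps_offP[] : a \in comps_off R by rewrite aE inE.
have compE (x : del_verts R) : comp_off R (val x) = a.
  apply/eqP; rewrite -in_set1 -aE; apply/imsetP; exists (val x) => //.
  by rewrite inE (valP x).
split; first by apply/card_gt0P; exists (Sub a aR).
by move=> x y; rewrite connect_del_verts; apply/comp_offP; rewrite !compE.
Qed.

(** * Existence of components and of vertices touching many of them *)

Lemma comps_off_gt0 R :
  1 < #|G| -> connected_graph (del_edges_within R) -> 0 < #|comps_off R|.
Proof.
move=> G_gt1 [_ Gc]; rewrite card_gt0; apply/negP => /eqP comps0.
have inR x : x \in R.
  apply/negPn/negP => xR.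
  have : comp_off R x \in comps_off R by apply: imset_f; rewrite inE.
  by rewrite comps0 inE.
have [x [y [_ _ xy]]] : exists x y : G, [/\ x \in G, y \in G & x != y].
  exact/card_gt1P.
(* With every vertex in [R] no edge survives, so a single vertex is closed. *)
have cl : closed (@adj (del_edges_within R)) (pred1 x).
  by move=> z t /=; rewrite /del_edges_within_adj !inR andbF.
have := closed_connect cl (Gc x y).
by rewrite !inE eqxx eq_sym (negbTE xy).
Qed.

(** Otherwise a component [a], together with the vertices of [R] touching it, is closed under the
    surviving edges, yet it misses another component [b]. *)
Lemma exists_touch2 R :
  connected_graph (del_edges_within R) -> 1 < #|comps_off R| ->
  exists2 v, v \in R & 1 < #|touched_comps R v|.
Proof.
move=> [_ Gc] /card_gt1P[a [b [/comps_offP[aR ra] /comps_offP[bR rb] ab]]].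
have [/exists_inP[v vR tv]|] := boolP [exists v in R, 1 < #|touched_comps R v|].
  by exists v.
rewrite negb_exists_in => /forall_inP small; exfalso.
have touch1 v c d : v \in R -> c \in touched_comps R v ->
    d \in touched_comps R v -> c = d.
  move=> vR; have /card_le1_eqP eqT : #|touched_comps R v| <= 1.
    by rewrite leqNgt small.
  by move=> cT dT; exact: eqT.
have touch v y : y \notin R -> adj v y -> comp_off R y \in touched_comps R v.
  by move=> yR vy; apply/imsetP; exists y; rewrite // !inE yR.
pose X := [pred x | if x \in R then a \in touched_comps R x
                    else comp_off R x == a].
(* Every surviving edge has an endpoint outside [R], so by symmetry this case suffices. *)
have half x y : x \notin R -> adj x y -> (x \in X) = (y \in X).
  rewrite !inE => xR xy; rewrite (negbTE xR).
  have [yR|yR] := boolP (y \in R); last by rewrite (adj_comp_off xy xR yR).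
  have tx : comp_off R x \in touched_comps R y by rewrite touch // adj_sym.
  by apply/eqP/idP => [<- //|ta]; apply: touch1 yR _ _.
have cl : closed (@adj (del_edges_within R)) X.
  move=> x y /andP[xy]; rewrite negb_and => /orP[xR|yR]; first exact: half.
  by apply/esym/half; rewrite // adj_sym.
have := closed_connect cl (Gc a b).
by rewrite !inE (negbTE aR) (negbTE bR) ra rb eqxx eq_sym (negbTE ab).
Qed.

(** A path leaving the component [a] must pass through a vertex of [R] touching it. Deleting all of
    these separates [a] from another component [b], which fewer than [r] vertices cannot do. *)
Lemma touching_ge R r a : r_connected r G ->
  a \in comps_off R -> 1 < #|comps_off R| ->
  r <= #|[set v in R | a \in touched_comps R v]|.
Proof.
move=> [_ Gr] aC; rewrite (cardsD1 a) aC ltnS => /card_gt0P[b].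
rewrite !inE => /andP[ba /comps_offP[bR rb]].
have [aR ra] := comps_offP _ _ aC.
set N := [set v in R | _]; rewrite leqNgt; apply/negP => /Gr[_ Nc].
have notN x : x \notin R -> x \notin N by rewrite inE => /negbTE ->.
pose X := [pred x : del_verts N | (val x \notin R) && (comp_off R (val x) == a)].
have half (x y : del_verts N) : adj (val x) (val y) -> x \in X -> y \in X.
  rewrite !inE => xy /andP[xR /eqP rx].
  have [yR|yR] := boolP (val y \in R); last first.
    by rewrite -(adj_comp_off xy xR yR) rx /=.
  have := valP y; rewrite inE yR /= => /negP[]; apply/imsetP; exists (val x) => //.
  by rewrite !inE xR adj_sym.
have cl : closed (@adj (del_verts N)) X.
  by move=> x y xy; apply/idP/idP; apply: half; rewrite // adj_sym.
have := closed_connect cl (Nc (Sub a (notN a aR)) (Sub b (notN b bR))).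
by rewrite !inE !SubK aR bR ra rb eqxx (negbTE ba).
Qed.

(** Double counting of the pairs of a vertex of [R] and a component it touches: each component lies
    in at least [r] pairs, so not every vertex can lie in at most [c]. *)
Lemma exists_touch_gt R r c : r_connected r G -> 1 < #|comps_off R| ->
  c * #|R| < r * #|comps_off R| ->
  exists2 v, v \in R & c < #|touched_comps R v|.
Proof.
move=> Gr k_gt1 lt_cr.
have [/exists_inP[v vR tv]|] := boolP [exists v in R, c < #|touched_comps R v|].
  by exists v.
rewrite negb_exists_in => /forall_inP small; exfalso.
move: lt_cr; rewrite ltnNge => /negP[].
apply: (@leq_trans (\sum_(v in R) #|touched_comps R v|)); last first.
  by rewrite mulnC -sum_nat_const; apply: leq_sum => v vR; rewrite leqNgt small.
rewrite mulnC -sum_nat_const.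
apply: (@leq_trans (\sum_(a in comps_off R) \sum_(v in R) (a \in touched_comps R v))).
  apply: leq_sum => a aC; apply: leq_trans (touching_ge Gr aC k_gt1) _.
  rewrite -sum1_card big_mkcond [leqRHS]big_mkcond /=; apply: leq_sum => v _.
  by rewrite inE; case: (v \in R); case: (a \in _).
rewrite exchange_big /=; apply: leq_sum => v _.
rewrite -sum1_card big_mkcond [leqRHS]big_mkcond /=; apply: leq_sum => a _.
by case: (a \in comps_off R); case: (a \in _).
Qed.

Lemma del_edges_within_connectedS R R1 : R1 \subset R ->
  connected_graph (del_edges_within R) -> connected_graph (del_edges_within R1).
Proof.
move=> sR [G0 Gc]; split=> // x y; apply: connect_sub (Gc x y) => z t.
case/andP => zt ztR; apply: connect1; apply/andP; split=> //.
by apply: contra ztR => /andP[zR tR]; rewrite !(subsetP sR).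
Qed.

End Components.

Local Open Scope ring_scope.

(** * The linear forms whose maximum is the bound *)

Section Lines.
Variables (K : realType) (r : nat).
Hypothesis r_ge3 : (3 <= r)%N.
Implicit Types (n y : K) (i j : nat).

(* [n * (epsilon r)(y / n)] when [i.+1 <= y / n <= i.+2]; for [i = 0] the range
   extends down to [y = 0]. *)
Definition epsilon_line i n y : K :=
  epsilon r (i.+1)%:R / (r%:R - 1) * (r%:R * n - y / (i.+1)%:R).

Let rK : 3 <= r%:R :> K. Proof. by rewrite (ler_nat K 3). Qed.

Lemma epsilon1 : epsilon r 1 = (r%:R - 1) / r%:R :> K.
Proof.
by rewrite epsilon_le2; [field; apply/eqP; move: rK; lra | lra].
Qed.

(** The defining recursion starts above 2, but the value [1 - 2 / r] at 2 also follows from the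
    value at 1 by the same rule, so no case split is needed later. *)
Lemma epsilon_nat_step i :
  epsilon r (i.+2)%:R
    = epsilon r (i.+1)%:R * (1 - ((r%:R - 1) * (i.+1)%:R)^-1) :> K.
Proof.
case: i => [|i].
  rewrite epsilon1 epsilon_le2 //; field.
  by apply/andP; split; apply/eqP; move: rK; lra.
rewrite epsilon_gt2 ?(ltr_nat K 2) //.
have -> : (Num.ceil (i.+3%:R : K))%:~R = i.+3%:R :> K.
  by rewrite pmulrn intrKceil.
have -> : i.+3%:R - 1 = i.+2%:R :> K by rewrite -(natr1 i.+2) addrK.
by rewrite addrK mul1r.
Qed.

Lemma epsilon_nat_ge0 i : 0 <= epsilon r (i.+1)%:R :> K.
Proof.
elim: i => [|i IH]; first by rewrite epsilon1 divr_ge0; move: rK; lra.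
rewrite epsilon_nat_step mulr_ge0 // subr_ge0 invf_le1.
  have : 1 <= i.+1%:R :> K by rewrite (ler_nat K 1).
  by move: rK; nra.
by rewrite mulr_gt0 ?ltr0n //; move: rK; lra.
Qed.

Lemma epsilon_nat_le i : epsilon r (i.+1)%:R <= (r%:R - 1) / r%:R :> K.
Proof.
elim: i => [|i IH]; first by rewrite epsilon1.
apply: le_trans IH; rewrite epsilon_nat_step ler_piMr ?epsilon_nat_ge0 //.
rewrite gerBl invr_ge0 mulr_ge0 //; move: rK; lra.
Qed.

(** This is convexity: consecutive forms agree on the ray [y = (i + 2) n], and the later one has the
    larger slope in [y]. *)
Lemma epsilon_line_cross i n y :
  exists2 s, 0 <= s &
    epsilon_line i.+1 n y - epsilon_line i n y = s * (y - (i.+2)%:R * n).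
Proof.
rewrite /epsilon_line epsilon_nat_step.
have e0 := epsilon_nat_ge0 i; set E := epsilon _ _ in e0 *.
have r1 : r%:R - 1 != 0 :> K by apply/eqP; move: rK; lra.
have i0 : 0 <= i%:R :> K by [].
have -> : i.+2%:R = i%:R + 2 :> K by rewrite -addn2 natrD.
have -> : i.+1%:R = i%:R + 1 :> K by rewrite natr1.
have i1 : i%:R + 1 != 0 :> K by apply/eqP; lra.
have i2 : i%:R + 2 != 0 :> K by apply/eqP; lra.
exists (E * r%:R / ((r%:R - 1) ^+ 2 * (i%:R + 1) * (i%:R + 2))).
  rewrite divr_ge0 ?mulr_ge0 ?exprn_ge0 //; move: rK; lra.
by field; rewrite i1 i2 r1.
Qed.

(** Passing from form [j] up to form [i] crosses only breaks at ratios at most [i + 1], so no step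
    decreases the value. With the next lemma, form [i] is the largest on its range. *)
Lemma epsilon_line_le_left i j n y : 0 <= n -> (j <= i)%N ->
  (i.+1)%:R * n <= y -> epsilon_line j n y <= epsilon_line i n y.
Proof.
move=> n0; elim: i => [|i IH]; first by case: j.
rewrite leq_eqVlt => /orP[/eqP -> //|]; rewrite ltnS => ji iy.
have [s s0 sE] := epsilon_line_cross i n y.
apply: le_trans (IH ji _) _.
  by apply: le_trans iy; rewrite ler_wpM2r // ler_nat.
by rewrite -subr_ge0 sE mulr_ge0 // subr_ge0.
Qed.

Lemma epsilon_line_le_right i j n y : 0 <= n -> (i <= j)%N ->
  y <= (i.+2)%:R * n -> epsilon_line j n y <= epsilon_line i n y.
Proof.
move=> n0 + iy; elim: j => [|j IH]; first by case: i iy.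
rewrite leq_eqVlt => /orP[/eqP -> //|]; rewrite ltnS => ij.
apply: le_trans (IH ij).
have [s s0 sE] := epsilon_line_cross j n y.
rewrite -subr_le0 sE mulr_ge0_le0 // subr_le0.
by apply: le_trans iy _; rewrite ler_wpM2r // ler_nat.
Qed.

(** This serves the base case, where all of [R] is removed. Each form is largest at [y = 0], where
    its value is at most [n] because its coefficient is bounded by that of form 0. *)
Lemma epsilon_line_le i n y : 0 <= n -> 0 <= y -> epsilon_line i n y <= n.
Proof.
move=> n0 y0; have e0 := epsilon_nat_ge0 i; have e1 := epsilon_nat_le i.
have r1 : 0 < r%:R - 1 :> K by move: rK; lra.
rewrite /epsilon_line mulrAC ler_pdivrMr //.
apply: le_trans (_ : (r%:R - 1) / r%:R * (r%:R * n) <= _); last first.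
  rewrite mulrA divfK ?[n * _]mulrC //; apply/eqP; move: rK; lra.
apply: le_trans (ler_wpM2r _ e1); last by rewrite mulr_ge0.
by rewrite ler_wpM2l // gerBl divr_ge0.
Qed.

Lemma epsilon_line_antitone i n y y' : y' <= y ->
  epsilon_line i n y <= epsilon_line i n y'.
Proof.
move=> yy; rewrite ler_wpM2l //.
  by rewrite divr_ge0 ?epsilon_nat_ge0 //; move: rK; lra.
by rewrite lerD2l lerN2 ler_wpM2r // invr_ge0.
Qed.

(** With [y = r k], this trades one vertex of [R] for [i + 1] components. *)
Lemma epsilon_line_shift i n y :
  epsilon_line i (n - 1) (y - r%:R * (i.+1)%:R) = epsilon_line i n y.
Proof.
rewrite /epsilon_line; congr (_ * _).
have : i.+1%:R != 0 :> K by rewrite pnatr_eq0.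
by move: (i.+1%:R) => c c0; field.
Qed.

(** Both sides are linear in [n], so the form depends on [d] alone. *)
Lemma epsilon_lineE (d : K) : 0 < d ->
  exists i, forall n, epsilon r d * n = epsilon_line i n (d * n).
Proof.
move=> d0; have r1 : r%:R - 1 != 0 :> K by apply/eqP; move: rK; lra.
have r0 : r%:R != 0 :> K by apply/eqP; move: rK; lra.
have [d2|d2] := leP d 2.
  exists 0%N => n; rewrite /epsilon_line epsilon1 epsilon_le2 //; field.
  by rewrite r0 r1.
have c2 : (2 < Num.ceil d)%R by rewrite ceil_gt_int.
(* The ceiling of [d] is now [c + 2], so [d] lies between [c + 1] and [c + 2], the range of form
   [c]. *)
case Ec: (Num.ceil d) c2 => [[|[|c]]|] // _.
exists c => n; rewrite /epsilon_line epsilon_gt2 // Ec -pmulrn.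
have -> : c.+2%:R - 1 = c.+1%:R :> K by rewrite -(natr1 c.+1) addrK.
rewrite -(natr1 c.+1).
have : c.+1%:R != 0 :> K by rewrite pnatr_eq0.
by move: (c.+1%:R) => x x0; field; rewrite x0 r1.
Qed.

End Lines.

(** * Induction on the size of [R] *)

Section Main.
Variables (K : realType) (r : nat) (G : sgraph).
Hypotheses (r_ge3 : (3 <= r)%N) (G_conn : r_connected r G).

Lemma exists_line_and_vertex (R : {set G}) :
  connected_graph (del_edges_within R) -> (1 < #|comps_off R|)%N ->
  exists i v, [/\ v \in R, (i.+1 < #|touched_comps R v|)%N
    & forall j, epsilon_line r j #|R|%:R (r * #|comps_off R|)%:R
        <= epsilon_line r i #|R|%:R (r * #|comps_off R|)%:R :> K].
Proof.
move=> Gc k_gt1; set k := #|comps_off R| in k_gt1 *.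
have [v0 v0R tv0] := exists_touch2 Gc k_gt1.
have R0 : (0 < #|R|)%N by apply/card_gt0P; exists v0.
(* At ratio at most 2 averaging may not yield two touched components, so the vertex supplied by
   connectivity is used with form 0. *)
have [small|big] := leqP (r * k) (2 * #|R|).
  exists 0%N, v0; split=> // j; apply: epsilon_line_le_right => //.
  by rewrite -natrM ler_nat.
(* The predecessor makes [c] the ceiling of [r k / #|R|] minus one, so that [c] lies strictly below
   the ratio, as the averaging argument requires, and [c + 1] is at least the ratio. *)
pose c := ((r * k).-1 %/ #|R|)%N.
have c_ge1 : (2 <= c)%N by rewrite leq_divRL //; lia.
have lo : (c * #|R| < r * k)%N by have := leq_divM (r * k).-1 #|R|; rewrite -/c; lia.
have hi : (r * k <= c.+1 * #|R|)%N by have := ltn_ceil (r * k).-1 R0; rewrite -/c; lia.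
have [v vR tv] := exists_touch_gt G_conn k_gt1 lo.
exists c.-1, v; rewrite prednK; last lia.
split=> // j; have [jc|cj] := leqP j c.-1.
  by apply: epsilon_line_le_left => //; rewrite prednK -?natrM ?ler_nat; lia.
by apply: epsilon_line_le_right; rewrite // 1?ltnW // prednK -?natrM ?ler_nat; lia.
Qed.

(** Allowing every [i] amounts to bounding by the maximum of the forms, so the induction hypothesis
    can be applied with the form [j] that is best for the current [R]. *)
Lemma exists_removable (R : {set G}) i :
  connected_graph (del_edges_within R) ->
  exists R' : {set G}, [/\ R' \subset R,
    epsilon_line r i #|R|%:R (r * #|comps_off R|)%:R <= #|R'|%:R :> K
    & connected_graph (del_verts R')].
Proof.
have [m] := ubnP #|R|; elim: m R i => // m IH R i; rewrite ltnS => Rm Gc.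
have G_gt1 : (1 < #|G|)%N by have [? _] := G_conn; lia.
have := comps_off_gt0 G_gt1 Gc; rewrite leq_eqVlt => /orP[/eqP k1|k_gt1].
  exists R; split=> //; first exact: epsilon_line_le.
  exact: del_verts_connected.
have [j [v [vR tv best]]] := exists_line_and_vertex Gc k_gt1.
have cardR := cardsD1 v R; rewrite vR in cardR.
have [||R' [R'R le_R' R'c]] := IH (R :\ v) j; first lia.
  by apply: del_edges_within_connectedS Gc; exact: subD1set.
exists R'; split=> //; first exact: subset_trans R'R (subD1set _ _).
apply: le_trans (best i) _; apply: le_trans le_R'.
rewrite -epsilon_line_shift.
have -> : #|R|%:R - 1 = #|R :\ v|%:R :> K by rewrite cardR natrD addrC addKr.
apply: epsilon_line_antitone => //.
(* Merging [t] components through [v] loses [t - 1] of them, and [t] is at least [j + 2], so at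
   least [j + 1] are lost. *)
rewrite lerBrDr -natrM -natrD ler_nat -mulnDr leq_mul2l; apply/orP; right.
have := card_comps_off_del R v; lia.
Qed.

End Main.

Theorem theorem6 (K : realType) (d : K) (r : nat) (G : sgraph) (R : {set G})
    (d_gt0 : 0 < d) (r_ge3 : (3 <= r)%N)
    (G_conn : r_connected r G)
    (GR_conn : connected_graph (del_edges_within R))
    (comp_le : (num_components (del_verts R))%:R <= d / r%:R * #|R|%:R) :
  exists R' : {set G},
    [/\ R' \subset R,
        epsilon r d * #|R|%:R <= #|R'|%:R
      & connected_graph (del_verts R')].
Proof.
have [i iE] := epsilon_lineE r_ge3 d_gt0.
have [R' [R'R le_R' R'c]] := exists_removable K r_ge3 G_conn i GR_conn.
exists R'; split=> //; rewrite iE; apply: le_trans le_R'.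
(* The hypothesis says that [r k] is at most [d #|R|], and the forms decrease in [y]. *)
apply: epsilon_line_antitone => //.
have r_gt0 : 0 < r%:R :> K by rewrite ltr0n; lia.
by rewrite natrM mulrC -ler_pdivlMr // mulrAC -num_components_del_verts.
Qed.
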